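(* Let $W:\mathcal X\to\mathcal Y$ be a binary-input DMC ($\mathcal X=\{0,1\}$), fix an input distribution and an integer $L\ge 2$, and let $(Q,\Phi)$, with $Q:\mathcal X\to\mathcal Z$ and $\Phi:\mathcal Z\to\mathcal Y$, be an optimizer of $$\min\{I(Q)-I(W):\ W\preccurlyeq Q \text{ via }\Phi,\ |\mathcal Z|\le L\},$$ such that the posterior vectors $\{\mathbf z\}_{z\in\mathcal Z}$ are pairwise distinct. Then $\{\mathbf z\}_{z\in\mathcal Z}\subseteq\{\mathbf y\}_{y\in\mathcal Y}$. Moreover, for $y\in\mathcal Y$ and $z\in\mathcal Z$, $\Phi(y|z)>0$ implies that $z$ is either the letter with the largest $z_0$ among those with $z_0\le y_0$, or the letter with the smallest $z_0$ among those with $z_0\ge y_0$.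
   Context: $\mathcal Y,\mathcal Z$ finite and disjoint from $\mathcal X=\{0,1\}$. $W\preccurlyeq Q$ via $\Phi$ means $W(y|x)=\sum_zQ(z|x)\Phi(y|z)$ for all $x,y$. A fixed input distribution $\pi(x)>0$ induces output probabilities $\pi_y=\sum_x\pi(x)W(y|x)>0$, $\pi_z=\sum_x\pi(x)Q(z|x)>0$, and posterior vectors $\mathbf y=(y_0,y_1)$ with $y_x=\pi(x)W(y|x)/\pi_y$ and $\mathbf z=(z_0,z_1)$ with $z_x=\pi(x)Q(z|x)/\pi_z$. $I(\cdot)$ is input–output mutual information (natural log). *)

(* Defs.v *)
From HB Require Import structures.
From mathcomp Require Import all_boot.
From Stdlib Require Import Reals.
Set Implicit Arguments. Unset Strict Implicit. Unset Printing Implicit Defensive.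

HB.instance Definition _ := Monoid.isComLaw.Build R 0%R Rplus
  (fun a b c => esym (Rplus_assoc a b c)) Rplus_comm Rplus_0_l.

Notation "\rsum_ ( i : T ) F" := (\big[Rplus/0%R]_(i : T) F)
  (at level 41, F at level 41, i, T at level 50) : R_scope.

Local Open Scope R_scope.

Definition stochastic (A B : finType) (ch : A -> B -> R) : Prop :=
  (forall a b, 0 <= ch a b) /\ (forall a, \rsum_(b : B) ch a b = 1).

Definition input_dist (pi : bool -> R) : Prop :=
  (forall x, 0 < pi x) /\ pi false + pi true = 1.

Definition outp (B : finType) (pi : bool -> R) (ch : bool -> B -> R) (b : B) : R :=
  \rsum_(x : bool) pi x * ch x b.

(* posterior vector: post x = pi(x) ch(b|x) / pi_b ; x = false is letter 0 *)
Definition post (B : finType) (pi : bool -> R) (ch : bool -> B -> R) (b : B) (x : bool) : R :=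
  pi x * ch x b / outp pi ch b.

(* mutual information, natural log, with 0 ln 0 = 0 convention *)
Definition mutinf (B : finType) (pi : bool -> R) (ch : bool -> B -> R) : R :=
  \rsum_(x : bool) \rsum_(b : B)
     (if Req_EM_T (ch x b) 0 then 0
      else pi x * ch x b * ln (ch x b / outp pi ch b)).

Definition degraded_via (Y Z : finType) (W : bool -> Y -> R) (Q : bool -> Z -> R)
  (Phi : Z -> Y -> R) : Prop :=
  forall x y, W x y = \rsum_(z : Z) Q x z * Phi z y.

(* Main.v *)
Require Import Defs.
From HB Require Import structures.
From mathcomp Require Import all_boot.
From Stdlib Require Import Reals Lra Classical.
From Coquelicot Require Import Coquelicot.
Local Open Scope R_scope.

(* Let m(z,y) = pi_z Phi(y|z) and a_z = z_0.  Up to a constant, I(Q) is the cost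
   sum m(z,y) g(a_z) with g(x) = x ln x + (1-x) ln(1-x), and feasibility only fixes, for each
   y, the mass sum_z m(z,y) and the first moment sum_z m(z,y) a_z; so (m,a) is an optimal
   transport plan.  Replacing mass of y at two letters by mass at a letter strictly between
   them lowers the cost by strict convexity, which gives the adjacency claim.  If a_z is no
   posterior of W, every y served by z is also served by some other position c_y <> a_z, and
   a_z can be moved to a_z + s while the masses at a_z and c_y are rebalanced.  With d(c) the
   binary divergence of c from t = a_z and w = c - t, the cost changes by
   sum_y m(z,y) (w_y d(t+s) - s d(c_y)) / (w_y - s).
   If sum m d/w <> 0, a small s of suitable sign improves.  Otherwise the s^2 coefficient
   sum m (1/(2t(1-t)) - d/w^2) is negative, because of the Bernstein-type bound
   d(t+w) > w^2 / (2 (t(1-t) + (1-2t) w/3)), whose correction is linear in w and hence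
   cancels on average. *)

(** * Binary divergence and its quadratic bounds *)

Definition negent (x : R) : R := x * ln x + (1 - x) * ln (1 - x).

(** Binary divergence of [x] from [t]. Differences of logarithms, instead of logarithms of
    quotients, let its identities follow by [ring] for all reals; at [x = 0] and [x = 1] the
    logarithm of zero has coefficient zero. *)
Definition bkl (t x : R) : R :=
  x * (ln x - ln t) + (1 - x) * (ln (1 - x) - ln (1 - t)).

(** The divergence is the Bregman remainder of [negent]; the affine part will cancel by conservation
    of mass and mean. *)
Lemma negent_tangent (t x : R) :
  negent x = negent t + (ln t - ln (1 - t)) * (x - t) + bkl t x.
Proof. rewrite /negent /bkl; ring. Qed.

Lemma bkl_refl (t : R) : bkl t t = 0.
Proof. rewrite /bkl; ring. Qed.

Lemma bkl_symm (t x : R) : bkl (1 - t) (1 - x) = bkl t x.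
Proof.
rewrite /bkl.
have -> : 1 - (1 - x) = x by ring.
have -> : 1 - (1 - t) = t by ring.
ring.
Qed.

Lemma MVT_incr (f f' : R -> R) (a b : R) : a < b ->
  (forall c, a <= c <= b -> is_derive f c (f' c)) ->
  (forall c, a < c < b -> 0 < f' c) -> f a < f b.
Proof.
move=> ab df pf.
have [|c [e cab]] := @MVT_cor2 f f' a b ab.
  by move=> c hc; apply/is_derive_Reals/df.
have := pf c cab => h.
have := Rmult_lt_0_compat _ (b - a) h; lra.
Qed.

Lemma MVT_decr (f f' : R -> R) (a b : R) : a < b ->
  (forall c, a <= c <= b -> is_derive f c (f' c)) ->
  (forall c, a < c < b -> f' c < 0) -> f b < f a.
Proof.
move=> ab df nf; suff : - f a < - f b by lra.
apply: (@MVT_incr (fun x => - f x) (fun x => - f' x) a b ab) => c hc.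
  by apply: is_derive_opp; apply: df.
by have := nf c hc; lra.
Qed.

(* [(x - t)^2 / (2 * bkl_den t x)] agrees with [bkl t x] to third order at [x = t]. *)
Definition bkl_den (t x : R) : R := t * (1 - t) + (1 - 2 * t) * (x - t) / 3.

(** Being affine in [x], the denominator interpolates between t(2-t)/3 at 0 and (1-t)(1+t)/3 at 1,
    both positive. *)
Lemma bkl_den_gt0 (t x : R) : 0 < t < 1 -> 0 <= x <= 1 -> 0 < bkl_den t x.
Proof.
move=> ht hx; rewrite /bkl_den.
have -> : t * (1 - t) + (1 - 2 * t) * (x - t) / 3 =
  ((1 - x) * (t * (2 - t)) + x * ((1 - t) * (1 + t))) / 3 by field.
have h1 : 0 < t * (2 - t) by apply: Rmult_lt_0_compat; lra.
have h2 : 0 < (1 - t) * (1 + t) by apply: Rmult_lt_0_compat; lra.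
nra.
Qed.

(** Differentiating in the base point [t] rather than in [x] leaves a rational function, whose sign
    is that of [t - x]. *)
Lemma bkl_gap_derive (t x : R) : 0 < t < 1 -> 0 <= x <= 1 ->
  is_derive (fun t => bkl t x - (x - t) ^ 2 / (2 * bkl_den t x)) t
   (- (x - t) ^ 3 * (((1 - 2 * t) / 3) ^ 2 + t * (1 - t) / 3) /
     (t * (1 - t) * bkl_den t x ^ 2)).
Proof.
move=> ht hx; have := bkl_den_gt0 t x ht hx.
rewrite /bkl /bkl_den => hB.
auto_derive.
  repeat split; try lra.
field; repeat split; try lra.
all: move: hB; lra.
Qed.

(** For [x = 0] the denominator degenerates as the base point tends to 0. Once a factor [t] is
    cancelled, the gap extends to base point 0, where it vanishes, and it increases from there. *)
Lemma bkl_gt0_end (t : R) : 0 < t < 1 -> (0 - t) ^ 2 / (2 * bkl_den t 0) < bkl t 0.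
Proof.
move=> ht.
have -> : bkl t 0 = - ln (1 - t) by rewrite /bkl Rminus_0_r ln_1; ring.
have -> : (0 - t) ^ 2 / (2 * bkl_den t 0) = 3 / 2 * (t / (2 - t)).
  by rewrite /bkl_den; field; nra.
pose f t := - ln (1 - t) - 3 / 2 * (t / (2 - t)).
suff : f 0 < f t.
  by rewrite /f Rminus_0_r ln_1; lra.
apply: (@MVT_incr f (fun t => (1 - t + t ^ 2) / ((1 - t) * (2 - t) ^ 2))); first lra.
- move=> c hc; rewrite /f; auto_derive; first by repeat split; lra.
  field; lra.
- move=> c hc; apply: Rdiv_lt_0_compat; first nra.
  apply: Rmult_lt_0_compat; first lra.
  apply: pow_lt; lra.
Qed.

(** For interior [x], the gap as a function of the base point vanishes at [x], decreases before it
    and increases after it. The endpoint 1 reduces to 0 by reflection. *)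
Lemma bkl_lower (t x : R) : 0 < t < 1 -> 0 <= x <= 1 -> x <> t ->
  (x - t) ^ 2 / (2 * bkl_den t x) < bkl t x.
Proof.
move=> ht hx xt.
have [x0|x0] := Req_dec x 0; first by rewrite x0; apply: bkl_gt0_end.
have [x1|x1] := Req_dec x 1.
  have := @bkl_gt0_end (1 - t).
  rewrite -(bkl_symm t x) x1.
  have -> : 1 - 1 = 0 by ring.
  have -> : bkl_den (1 - t) 0 = bkl_den t 1 by rewrite /bkl_den; field.
  have -> : (0 - (1 - t)) ^ 2 = (1 - t) ^ 2 by ring.
  by apply; lra.
pose f t := bkl t x - (x - t) ^ 2 / (2 * bkl_den t x).
have f0 : f x = 0 by rewrite /f bkl_refl Rminus_diag /Rdiv; ring.
suff : 0 < f t by rewrite /f; lra.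
have dpos c : 0 < c < 1 ->
   0 < (((1 - 2 * c) / 3) ^ 2 + c * (1 - c) / 3) / (c * (1 - c) * bkl_den c x ^ 2).
  move=> hc; have hB := bkl_den_gt0 c x hc hx.
  have hcc : 0 < c * (1 - c) by apply: Rmult_lt_0_compat; lra.
  apply: Rdiv_lt_0_compat.
    have := pow2_ge_0 ((1 - 2 * c) / 3); lra.
  by apply: Rmult_lt_0_compat => //; apply: pow_lt.
have [lt|gt] : x < t \/ t < x by lra.
- rewrite -f0; apply: (@MVT_incr f _ x t lt).
    by move=> c hc; apply: bkl_gap_derive; lra.
  move=> c hc; rewrite /Rdiv Rmult_assoc; apply: Rmult_lt_0_compat.
    by have := pow_lt (c - x) 3; have -> : (c - x) ^ 3 = - (x - c) ^ 3; [ring|lra].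
  by apply: dpos; lra.
- rewrite -f0; apply: (@MVT_decr f _ t x gt).
    by move=> c hc; apply: bkl_gap_derive; lra.
  move=> c hc; rewrite /Rdiv Rmult_assoc -!Ropp_mult_distr_l.
  apply: Ropp_lt_gt_0_contravar; apply: Rmult_lt_0_compat.
    by apply: pow_lt; lra.
  by apply: dpos; lra.
Qed.

Lemma bkl_gt0 (t x : R) : 0 < t < 1 -> 0 <= x <= 1 -> x <> t -> 0 < bkl t x.
Proof.
move=> ht hx xt; apply: Rle_lt_trans (bkl_lower t x ht hx xt).
apply: Rdiv_le_0_compat; first exact: pow2_ge_0.
have := bkl_den_gt0 t x ht hx; lra.
Qed.

Lemma bkl_ge0 (t x : R) : 0 < t < 1 -> 0 <= x <= 1 -> 0 <= bkl t x.
Proof.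
move=> ht hx; have [->|xt] := Req_dec x t; first by rewrite bkl_refl; lra.
by apply: Rlt_le; apply: bkl_gt0.
Qed.

(** The base point again runs from [x] to [t]. Since c(1-c) is 1-Lipschitz on [0,1], the hypothesis
    on [eta] keeps c(1-c) above [eta] along the way, which fixes the sign of the derivative. *)
Lemma bkl_upper (t x eta : R) : 0 < t < 1 -> 0 < x < 1 -> 0 < eta ->
  eta + Rabs (x - t) < t * (1 - t) -> bkl t x <= (x - t) ^ 2 / (2 * eta).
Proof.
move=> ht hx he hn.
pose f t := bkl t x - (x - t) ^ 2 / (2 * eta).
have f0 : f x = 0 by rewrite /f bkl_refl Rminus_diag /Rdiv; ring.
suff : f t <= 0 by rewrite /f; lra.
have df c : 0 < c < 1 -> is_derive f c ((x - c) * (/ eta - / (c * (1 - c)))).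
  move=> hc; rewrite /f /bkl; auto_derive; first by repeat split; lra.
  field; lra.
have dpos c : Rabs (c - t) <= Rabs (x - t) -> 0 < c < 1 -> 0 < / eta - / (c * (1 - c)).
  move=> h hc.
  suff : / (c * (1 - c)) < / eta by lra.
  apply: Rinv_0_lt_contravar => //.
  have : t * (1 - t) - c * (1 - c) <= Rabs (c - t).
    by move: h; rewrite /Rabs; do 2 case: Rcase_abs; nra.
  lra.
have [xt|[lt|gt]] : x = t \/ x < t \/ t < x by lra.
- by rewrite -xt f0; lra.
- apply: Rlt_le; rewrite -f0; apply: (@MVT_decr f _ x t lt).
    by move=> c hc; apply: df; lra.
  move=> c hc; cbv beta; rewrite -[x - c]Ropp_minus_distr -Ropp_mult_distr_l.
  apply: Ropp_lt_gt_0_contravar; apply: Rmult_lt_0_compat; first lra.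
  by apply: dpos; [rewrite /Rabs; do 2 case: Rcase_abs|]; lra.
- apply: Rlt_le; rewrite -f0.
  apply: (@MVT_incr f _ t x gt).
    by move=> c hc; apply: df; lra.
  move=> c hc.
  apply: Rmult_lt_0_compat; first lra.
  by apply: dpos; [rewrite /Rabs; do 2 case: Rcase_abs|]; lra.
Qed.

(** * Finite sums of reals *)

Lemma rsumM (I : finType) (c : R) (F : I -> R) :
  \rsum_(i : I) (c * F i) = c * \rsum_(i : I) F i.
Proof.
symmetry; apply: (big_morph (fun x => c * x)); first exact: Rmult_plus_distr_l.
exact: Rmult_0_r.
Qed.

Lemma rsumMr (I : finType) (c : R) (F : I -> R) :
  \rsum_(i : I) (F i * c) = (\rsum_(i : I) F i) * c.
Proof. by rewrite Rmult_comm -rsumM; apply: eq_bigr => i _; exact: Rmult_comm. Qed.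

Lemma rsumD (I : finType) (F G : I -> R) :
  \rsum_(i : I) (F i + G i) = \rsum_(i : I) F i + \rsum_(i : I) G i.
Proof. exact: big_split. Qed.

Lemma rsumB (I : finType) (F G : I -> R) :
  \rsum_(i : I) (F i - G i) = \rsum_(i : I) F i - \rsum_(i : I) G i.
Proof.
have -> : \rsum_(i : I) F i - \rsum_(i : I) G i =
  \rsum_(i : I) F i + -1 * \rsum_(i : I) G i by ring.
by rewrite -rsumM -rsumD; apply: eq_bigr => i _; ring.
Qed.

Lemma rsum0 (I : finType) : \rsum_(i : I) 0 = 0.
Proof. exact: big1_eq. Qed.

Lemma rsum_ge0 (I : finType) (F : I -> R) :
  (forall i, 0 <= F i) -> 0 <= \rsum_(i : I) F i.
Proof. by move=> F0; apply: big_ind => [|x y|i _]; [lra|lra|exact: F0]. Qed.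

Lemma rsum_le (I : finType) (F G : I -> R) :
  (forall i, F i <= G i) -> \rsum_(i : I) F i <= \rsum_(i : I) G i.
Proof. by move=> FG; apply: big_ind2 => [|x y x' y'|i _]; [lra|lra|exact: FG]. Qed.

Lemma rsum_lt (I : finType) (F G : I -> R) (j : I) :
  (forall i, F i <= G i) -> F j < G j -> \rsum_(i : I) F i < \rsum_(i : I) G i.
Proof.
move=> FG lt; rewrite (bigD1 j) //= [X in _ < X](bigD1 j) //=.
apply: Rplus_lt_le_compat => //.
by apply: big_ind2 => [|x y x' y'|i _]; [lra|lra|exact: FG].
Qed.

Lemma rsum_gt0 (I : finType) (F : I -> R) (j : I) :
  (forall i, 0 <= F i) -> 0 < F j -> 0 < \rsum_(i : I) F i.
Proof. by move=> F0 Fj; have := @rsum_lt I (fun=> 0) F j F0 Fj; rewrite rsum0. Qed.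

Lemma rsum_exists_gt0 (I : finType) (F : I -> R) :
  0 < \rsum_(i : I) F i -> exists i, 0 < F i.
Proof.
move=> h; apply: NNPP => no.
suff : \rsum_(i : I) F i <= \rsum_(i : I) 0 by rewrite rsum0; lra.
apply: rsum_le => i; apply: Rnot_lt_le => Fi; apply: no; by exists i.
Qed.

Lemma rsum_pick (I : finType) (j : I) (F : I -> R) :
  \rsum_(i : I) (if i == j then F i else 0) = F j.
Proof. by rewrite -big_mkcond big_pred1_eq. Qed.

(** * Properties holding near a point *)

Lemma locally_and (x : R) (P Q : R -> Prop) :
  locally x P -> locally x Q -> locally x (fun s => P s /\ Q s).
Proof. exact: filter_and. Qed.

Lemma locally_finite (I : finType) (P : I -> R -> Prop) (x : R) :
  (forall i, locally x (P i)) -> locally x (fun s => forall i, P i s).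
Proof.
move=> hP.
have h : locally x (fun s => forall i, i \in enum I -> P i s).
  elim: (enum I) => [|j r IH]; first exact: filter_forall.
  apply: filter_imp (locally_and _ _ _ (hP j) IH) => s [Pj Pr] i.
  by rewrite inE => /orP[/eqP ->|/Pr].
by apply: filter_imp h => s Ps i; apply: Ps; rewrite mem_enum.
Qed.

Lemma continuous_rsum (I : finType) (F : I -> R -> R) (x : R) :
  (forall i, continuous (F i) x) -> continuous (fun s => \rsum_(i : I) F i s) x.
Proof.
move=> cF; rewrite unlock.
elim: (index_enum I) => [|i r IH] /=; first exact: continuous_const.
apply: (@continuous_plus _ R_AbsRing R_NormedModule (F i)) => //.
Qed.

Lemma locally_gt0 (f : R -> R) (x : R) :
  continuous f x -> 0 < f x -> locally x (fun s => 0 < f s).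
Proof. move=> cf fx; apply: (cf (fun y => 0 < y)); exact: (open_gt 0). Qed.

Lemma locally_lt0 (f : R -> R) (x : R) :
  continuous f x -> f x < 0 -> locally x (fun s => f s < 0).
Proof. move=> cf fx; apply: (cf (fun y => y < 0)); exact: (open_lt 0). Qed.

(** Turns a property valid near 0 into a concrete displacement of prescribed sign; the next lemma is
    its mirror image. *)
Lemma locally_pos (P : R -> Prop) : locally 0 P -> exists s, 0 < s /\ P s.
Proof.
move=> [e he]; exists (e / 2); have := cond_pos e => e0; split; first lra.
by apply: he; rewrite /ball /= /AbsRing_ball /abs /minus /plus /opp /=;
   rewrite Ropp_0 Rplus_0_r Rabs_right; lra.
Qed.

Lemma locally_neg (P : R -> Prop) : locally 0 P -> exists s, s < 0 /\ P s.
Proof.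
move=> [e he]; exists (- (e / 2)); have := cond_pos e => e0; split; first lra.
by apply: he; rewrite /ball /= /AbsRing_ball /abs /minus /plus /opp /=;
   rewrite Ropp_0 Rplus_0_r Rabs_left; lra.
Qed.

(** * Optimal plans and the perturbations that would improve them *)

(** Transport with free support: masses and positions both vary, while each [y] keeps its total mass
    and first moment. *)
Definition optimal_plan {Y Z : finType} (m : Z -> Y -> R) (a : Z -> R) : Prop :=
  forall (m' : Z -> Y -> R) (a' : Z -> R),
    (forall z y, 0 <= m' z y) -> (forall z, 0 <= a' z <= 1) ->
    (forall y, \rsum_(z : Z) m' z y = \rsum_(z : Z) m z y) ->
    (forall y, \rsum_(z : Z) (m' z y * a' z) = \rsum_(z : Z) (m z y * a z)) ->
    \rsum_(y : Y) \rsum_(z : Z) (m z y * negent (a z)) <=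
    \rsum_(y : Y) \rsum_(z : Z) (m' z y * negent (a' z)).

Lemma optimal_plan_no_crossing (Y Z : finType) (m : Z -> Y -> R) (a : Z -> R)
    (y : Y) (z1 z2 z : Z) :
  optimal_plan m a -> (forall z y, 0 <= m z y) -> (forall z, 0 <= a z <= 1) ->
  0 < m z1 y -> 0 < m z2 y -> a z1 < a z -> a z < a z2 -> False.
Proof.
move=> opt m0 a01 h1 h2 lt1 lt2.
(* A mass that both outer letters can spare; the weight [lam] below puts the barycentre of what is
   removed at [a z]. *)
pose e := Rmin (m z1 y) (m z2 y).
have e0 : 0 < e by apply: Rmin_glb_lt.
have e1 : e <= m z1 y := Rmin_l _ _.
have e2 : e <= m z2 y := Rmin_r _ _.
pose lam := (a z2 - a z) / (a z2 - a z1).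
have lamE : lam * a z1 + (1 - lam) * a z2 = a z by rewrite /lam; field; lra.
have lam0 : 0 < lam by apply: Rdiv_lt_0_compat; lra.
have lam1 : lam < 1.
  have : 0 < (a z - a z1) / (a z2 - a z1) by apply: Rdiv_lt_0_compat; lra.
  have -> : (a z - a z1) / (a z2 - a z1) = 1 - lam by rewrite /lam; field; lra.
  lra.
have n1 : (z1 == z) = false by apply/eqP => E; rewrite E in lt1; lra.
have n2 : (z2 == z) = false by apply/eqP => E; rewrite E in lt2; lra.
have n12 : (z1 == z2) = false by apply/eqP => E; rewrite E in lt1; lra.
(* Signed change of column [y], with zero total mass and zero first moment. *)
pose dl z' := (if z' == z then e else 0) - (if z' == z1 then e * lam else 0)
   - (if z' == z2 then e * (1 - lam) else 0).
have sumdl (f : Z -> R) :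
  \rsum_(z' : Z) (dl z' * f z') = e * (f z - lam * f z1 - (1 - lam) * f z2).
  transitivity (\rsum_(z' : Z) ((if z' == z then e * f z' else 0)
     - (if z' == z1 then e * lam * f z' else 0)
     - (if z' == z2 then e * (1 - lam) * f z' else 0))).
    by apply: eq_bigr => z' _; rewrite /dl; do 3 case: (z' == _); ring.
  by rewrite !rsumB !rsum_pick; ring.
pose m' z' y' := m z' y' + (if y' == y then dl z' else 0).
have sumE (f : Z -> R) y' : \rsum_(z' : Z) (m' z' y' * f z') =
  \rsum_(z' : Z) (m z' y' * f z') +
    (if y' == y then e * (f z - lam * f z1 - (1 - lam) * f z2) else 0).
  rewrite /m'; case: eqP => _.
    by rewrite -sumdl -rsumD; apply: eq_bigr => z' _; ring.
  by rewrite Rplus_0_r; apply: eq_bigr => z' _; rewrite Rplus_0_r.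
have le : \rsum_(y' : Y) \rsum_(z' : Z) (m z' y' * negent (a z')) <=
   \rsum_(y' : Y) \rsum_(z' : Z) (m' z' y' * negent (a z')).
{ apply: opt => //.
  - move=> z' y'; rewrite /m'; case: (y' =P y) => [->|_]; last by have := m0 z' y'; lra.
    have := m0 z' y; rewrite /dl.
    case: (z' =P z) => [->|_]; first by rewrite eq_sym n1 eq_sym n2; lra.
    case: (z' =P z1) => [->|_]; first by rewrite n12; nra.
    by case: (z' =P z2) => [->|_]; nra.
  - move=> y'; rewrite -[LHS]Rmult_1_r -rsumMr (sumE (fun=> 1)) rsumMr.
    by case: ifP => _; ring.
  - by move=> y'; rewrite (sumE a) -lamE; case: ifP => _; ring. }
suff : \rsum_(y' : Y) \rsum_(z' : Z) (m' z' y' * negent (a z')) <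
   \rsum_(y' : Y) \rsum_(z' : Z) (m z' y' * negent (a z')) by lra.
have neg : e * (negent (a z) - lam * negent (a z1) - (1 - lam) * negent (a z2)) < 0.
  (* Expanding at the interior point [a z], the affine parts cancel by [lamE] and only divergences
     with negative weights remain. *)
  rewrite (negent_tangent (a z) (a z1)) (negent_tangent (a z) (a z2)).
  set c := ln _ - ln _.
  have b1 := bkl_gt0 (a z) (a z1); have b2 := bkl_ge0 (a z) (a z2).
  have ? := a01 z1; have ? := a01 z2.
  have -> : forall x A B, x - lam * (x + c * (a z1 - a z) + A)
     - (1 - lam) * (x + c * (a z2 - a z) + B) =
     c * (a z - (lam * a z1 + (1 - lam) * a z2)) - lam * A - (1 - lam) * B.
    by move=> *; ring.
  rewrite lamE; have := b1 ltac:(lra) ltac:(lra) ltac:(lra).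
  have := b2 ltac:(lra) ltac:(lra) => B A.
  have : 0 < lam * bkl (a z) (a z1) by apply: Rmult_lt_0_compat.
  have : 0 <= (1 - lam) * bkl (a z) (a z2) by apply: Rmult_le_pos; lra.
  by move=> ? ?; nra.
apply: (@rsum_lt _ _ _ y) => [y'|]; rewrite sumE ?eqxx; last lra.
by case: ifP => _; lra.
Qed.

(** Position [a z] moves to [a z + s]. For each [y], the fraction s/(w-s) of [m z y], with w =
    [a (nu y) - a z], is transferred from the partner [nu y] to [z] (backwards if negative), which
    restores the mean of [y]. The hypotheses keep both new masses nonnegative: the first inequality
    at [z], the second at the partner. *)
Lemma optimal_plan_move (Y Z : finType) (m : Z -> Y -> R) (a : Z -> R)
    (z : Z) (nu : Y -> Z) (s : R) :
  optimal_plan m a -> (forall z y, 0 <= m z y) -> (forall z, 0 <= a z <= 1) ->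
  (forall y, a (nu y) <> a z) -> 0 <= a z + s <= 1 ->
  (forall y, 0 < (a (nu y) - a z) * (a (nu y) - a z - s)) ->
  (forall y, m z y * (s / (a (nu y) - a z - s)) <= m (nu y) y) ->
  0 <= \rsum_(y : Y) (m z y *
    (s / (a (nu y) - a z - s) * (negent (a z + s) - negent (a (nu y))) +
     negent (a z + s) - negent (a z))).
Proof.
move=> opt m0 a01 anu t01 sep cap.
pose k y := s / (a (nu y) - a z - s).
have nuz y : (nu y == z) = false by apply/eqP => E; apply: (anu y); rewrite E.
have wsn y : a (nu y) - a z - s <> 0 by move=> E; have := sep y; rewrite E; lra.
have k1 y : 0 <= 1 + k y.
  have -> : 1 + k y =
     ((a (nu y) - a z) * (a (nu y) - a z - s)) / (a (nu y) - a z - s) ^ 2.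
    by rewrite /k; field; exact: wsn.
  apply: Rdiv_le_0_compat; first by apply: Rlt_le.
  by apply: pow2_gt_0.
pose a' z' := if z' == z then a z + s else a z'.
pose m' z' y := m z' y +
  ((if z' == z then m z y * k y else 0) - (if z' == nu y then m z y * k y else 0)).
(* One identity serves for mass (constant [f]), mean (identity) and cost ([negent]). *)
have sumE (f : R -> R) y : \rsum_(z' : Z) (m' z' y * f (a' z')) =
  \rsum_(z' : Z) (m z' y * f (a z')) +
   m z y * (k y * (f (a z + s) - f (a (nu y))) + f (a z + s) - f (a z)).
  transitivity (\rsum_(z' : Z) (m z' y * f (a z') +
    ((if z' == z then m z y * (k y * f (a z + s) + f (a z + s) - f (a z)) else 0) -
     (if z' == nu y then m z y * k y * f (a z') else 0)))).
    apply: eq_bigr => z' _; rewrite /m' /a'; case: (z' =P z) => [->|_].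
      by rewrite eq_sym nuz; ring.
    by case: (z' == nu y); ring.
  by rewrite rsumD rsumB !rsum_pick; ring.
have : \rsum_(y : Y) \rsum_(z' : Z) (m z' y * negent (a z')) <=
   \rsum_(y : Y) \rsum_(z' : Z) (m' z' y * negent (a' z')).
{ apply: opt.
  - move=> z' y; rewrite /m'; case: (z' =P z) => [->|_].
      rewrite eq_sym nuz; have := Rmult_le_pos _ _ (m0 z y) (k1 y); lra.
    case: (z' =P nu y) => [->|_]; last by have := m0 z' y; lra.
    by have := cap y; rewrite -/(k y); lra.
  - by move=> z'; rewrite /a'; case: ifP.
  - move=> y; rewrite -[LHS]Rmult_1_r -rsumMr (sumE (fun=> 1)) rsumMr; ring.
  - move=> y; rewrite (sumE (fun x => x)); rewrite /k; field; exact: wsn. }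
under [X in _ <= X]eq_bigr do rewrite sumE.
by rewrite rsumD; rewrite /k; lra.
Qed.

(** The move preserves mass and mean, so affine terms drop out and any base point [t] may be
    used. *)
Lemma move_cost_tangent (c t0 s t : R) : c - t0 - s <> 0 ->
  s / (c - t0 - s) * (negent (t0 + s) - negent c) + negent (t0 + s) - negent t0 =
  s / (c - t0 - s) * (bkl t (t0 + s) - bkl t c) + bkl t (t0 + s) - bkl t t0.
Proof.
move=> h; rewrite !(negent_tangent t c) !(negent_tangent t t0) !(negent_tangent t (t0 + s)).
by field.
Qed.

(** Provides a [y] served only from position [a z], which must then be its barycentre. If there were
    none, every [y] served by [z] would have a partner elsewhere and some small move of [a z] would
    lower the cost. *)
Lemma optimal_plan_partner (Y Z : finType) (m : Z -> Y -> R) (a : Z -> R)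
    (z : Z) (y0 : Y) :
  optimal_plan m a -> (forall z y, 0 <= m z y) -> (forall z, 0 <= a z <= 1) ->
  0 < m z y0 ->
  exists y, 0 < m z y /\ forall z', 0 < m z' y -> a z' = a z.
Proof.
move=> opt m0 a01 my0; apply: NNPP => no.
have part y : 0 < m z y -> exists z', 0 < m z' y /\ a z' <> a z.
  move=> my; apply: NNPP => no'; apply: no; exists y; split=> // z' mz'.
  by apply: NNPP => ne; apply: no'; exists z'.
have [zz [_ azz]] := part y0 my0.
(* Where [z] does not serve [y], any letter at another position, here [zz], is an adequate partner:
   the weight [m z y] is zero. *)
have [nu hnu] : exists nu : Y -> Z, forall y,
    a (nu y) <> a z /\ (0 < m z y -> 0 < m (nu y) y).
  apply: (@fin_all_exists Y (fun=> Z) (fun y u => a u <> a z /\ (0 < m z y -> 0 < m u y))).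
  move=> y; have [my|my] := Rlt_dec 0 (m z y); last by exists zz.
  by have [z' []] := part y my; exists z'.
have anu y := proj1 (hnu y).
pose w y := a (nu y) - a z.
have wn y : w y <> 0 by have := anu y; rewrite /w; lra.
have cont_inv y (f : R -> R) : continuous f 0 -> continuous (fun s => f s / (w y - s)) 0.
  move=> cf; apply: (@continuous_mult _ R_AbsRing f (fun s => / (w y - s))) => //.
  apply: (@ex_derive_continuous R_AbsRing R_NormedModule); auto_derive; have := wn y; lra.
have lsep : locally 0 (fun s => forall y, 0 < w y * (w y - s)).
  apply: locally_finite => y; apply: locally_gt0.
    by apply: (@ex_derive_continuous R_AbsRing R_NormedModule); auto_derive.
  have := wn y; nra.
(* The transferred mass tends to 0 with [s], while the partner of a served [y] has positive mass. *)
have lcap : locally 0 (fun s => forall y, m z y * (s / (w y - s)) <= m (nu y) y).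
  apply: locally_finite => y.
  have [my|my] := Rlt_dec 0 (m z y); last first.
    have -> : m z y = 0 by have := m0 z y; lra.
    by apply: filter_forall => s; rewrite Rmult_0_l.
  have : locally 0 (fun s => 0 < m (nu y) y - m z y * (s / (w y - s))).
    apply: locally_gt0.
      apply: (@continuous_minus _ R_AbsRing R_NormedModule (fun=> m (nu y) y)).
        exact: continuous_const.
      apply: (@continuous_mult _ R_AbsRing (fun=> m z y)); first exact: continuous_const.
      by apply: cont_inv; exact: continuous_id.
    rewrite /Rdiv Rmult_0_l Rmult_0_r; have := proj2 (hnu y) my; lra.
  by apply: filter_imp => s; lra.
have lfeas := locally_and _ _ _ lsep lcap.
have sepn s : (forall y, 0 < w y * (w y - s)) -> forall y, w y - s <> 0.
  by move=> h y E; have := h y; rewrite E; lra.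
have small : forall e, 0 < e -> locally 0 (fun s => Rabs s < e).
  move=> e he; exists (mkposreal e he) => s.
  by rewrite /ball /= /AbsRing_ball /abs /minus /plus /opp /= Ropp_0 Rplus_0_r.
(* If [a z] is an endpoint, all partners lie on the same side, so any small move
   towards them gains by strict convexity. *)
have oneside s : s <> 0 -> 0 < a z + s < 1 -> (forall y, 0 < s * w y) ->
    (forall y, 0 < w y * (w y - s)) ->
    (forall y, m z y * (s / (w y - s)) <= m (nu y) y) -> False.
  move=> s0 ht side sep cap.
  have := @optimal_plan_move Y Z m a z nu s opt m0 a01 anu ltac:(lra) sep cap.
  apply: Rlt_not_le.
  rewrite -[X in _ < X](rsum0 Y).
  have kp y : 0 < s / (w y - s).
    have -> : s / (w y - s) = (s * w y) * / (w y * (w y - s)).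
      by field; repeat split; first [exact: sepn | exact: wn | lra].
    by apply: Rmult_lt_0_compat => //; apply: Rinv_0_lt_compat.
  have neg y : s / (w y - s) * (negent (a z + s) - negent (a (nu y))) +
     negent (a z + s) - negent (a z) < 0.
    (* The base point is the new position, which is interior even when [a z] is an endpoint. *)
    rewrite (@move_cost_tangent _ _ _ (a z + s)); last exact: (sepn s sep y).
    rewrite bkl_refl -/(w y).
    have := bkl_gt0 (a z + s) (a z) ht (a01 z) ltac:(lra).
    have := Rmult_le_pos _ _ (Rlt_le _ _ (kp y)) (bkl_ge0 (a z + s) (a (nu y)) ht (a01 _)).
    lra.
  apply: (@rsum_lt _ _ _ y0) => [y|].
    by have := m0 z y; have := neg y; rewrite -/(w y); nra.
  by have := neg y0; rewrite -/(w y0); nra.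
have [z0|[z1|ht]] : a z = 0 \/ a z = 1 \/ 0 < a z < 1 by have := a01 z; lra.
{ have [s [s0 [[sep cap] s1]]] :=
    locally_pos _ (locally_and _ _ _ lfeas (small (1/2) ltac:(lra))).
  rewrite Rabs_right in s1; last lra.
  apply: (oneside s); rewrite ?z0; try lra; try done.
  move=> y; apply: Rmult_lt_0_compat => //; have := a01 (nu y); have := wn y; rewrite /w; lra. }
{ have [s [s0 [[sep cap] s1]]] :=
    locally_neg _ (locally_and _ _ _ lfeas (small (1/2) ltac:(lra))).
  rewrite Rabs_left in s1; last lra.
  apply: (oneside s); rewrite ?z1; try lra; try done.
  move=> y; have := a01 (nu y); have := wn y; rewrite /w; nra. }
pose h := a z * (1 - a z).
have h0 : 0 < h by apply: Rmult_lt_0_compat; lra.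
pose d y := bkl (a z) (a (nu y)).
(* The divergence of the new position from [a z] is replaced by its upper bound s^2/(2 eta), for
   [eta] below [h] and [s] small. *)
have cost s eta : 0 < eta < h -> Rabs s < h - eta -> Rabs s < a z -> Rabs s < 1 - a z ->
    (forall y, 0 < w y * (w y - s)) ->
    (forall y, m z y * (s / (w y - s)) <= m (nu y) y) ->
    0 <= \rsum_(y : Y) (m z y * (w y / (w y - s) * (s ^ 2 / (2 * eta)) - s * d y / (w y - s))).
  move=> he s1 s2 s3 sep cap.
  have ts : 0 < a z + s < 1.
    by move: s2 s3; rewrite /Rabs; case: Rcase_abs; lra.
  have := @optimal_plan_move Y Z m a z nu s opt m0 a01 anu ltac:(lra) sep cap.
  move=> /Rle_trans; apply; apply: rsum_le => y.
  apply: Rmult_le_compat_l => //.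
  rewrite (@move_cost_tangent _ _ _ (a z)); last exact: (sepn s sep y).
  rewrite bkl_refl -/(w y) -/(d y).
  have := @bkl_upper (a z) (a z + s) eta ht ts (proj1 he).
  have -> : a z + s - a z = s by ring.
  rewrite -/h => /(_ ltac:(lra)) up.
  have q : 0 <= w y / (w y - s).
    have -> : w y / (w y - s) = w y * (w y - s) / (w y - s) ^ 2.
      by field; exact: sepn.
    by apply: Rdiv_le_0_compat; [exact: Rlt_le|apply: pow2_gt_0; exact: sepn].
  have -> : s / (w y - s) * (bkl (a z) (a z + s) - d y) + bkl (a z) (a z + s) - 0 =
     w y / (w y - s) * bkl (a z) (a z + s) - s * d y / (w y - s).
    by field; exact: sepn.
  by have := Rmult_le_compat_l _ _ _ q up; lra.
have lfeas' eta : 0 < eta < h -> locally 0 (fun s =>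
    0 <= \rsum_(y : Y) (m z y * (w y / (w y - s) * (s ^ 2 / (2 * eta)) - s * d y / (w y - s)))).
  move=> he.
  have l1 := small (h - eta) ltac:(lra).
  have l2 := locally_and _ _ _ (small (a z) ltac:(lra)) (small (1 - a z) ltac:(lra)).
  apply: filter_imp (locally_and _ _ _ lfeas (locally_and _ _ _ l1 l2)).
  by move=> s [[? ?] [? [? ?]]]; apply: cost.
pose S1 := \rsum_(y : Y) (m z y * (d y / w y)).
have [S10|S1n] := Req_dec S1 0; last first.
(* [psi] is the bounded cost change divided by [s], taken with [eta = h / 2]. Its value at 0 is
   [- S1], nonzero, so [s] of the opposite sign to [psi 0] gives a contradiction. *)
{ pose psi s := \rsum_(y : Y) (m z y * ((w y * (s / h) - d y) / (w y - s))).
  have psiE s : (forall y, 0 < w y * (w y - s)) -> s * psi s =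
    \rsum_(y : Y) (m z y * (w y / (w y - s) * (s ^ 2 / (2 * (h / 2))) - s * d y / (w y - s))).
    move=> sep; rewrite /psi -rsumM; apply: eq_bigr => y _.
    by field; repeat split; first [exact: sepn | exact: wn | lra].
  have cpsi : continuous psi 0.
    apply: continuous_rsum => y.
    apply: (@continuous_mult _ R_AbsRing (fun=> m z y)); first exact: continuous_const.
    apply: cont_inv; apply: (@ex_derive_continuous R_AbsRing R_NormedModule).
    by auto_derive; lra.
  have psi0 : psi 0 = - S1.
    have -> : - S1 = -1 * S1 by ring.
    rewrite /S1 -rsumM; apply: eq_bigr => y _; field; repeat split; first [exact: sepn | exact: wn | lra].
  have lf := locally_and _ _ _ lsep (lfeas' (h / 2) ltac:(lra)).
  have [neg|pos] : psi 0 < 0 \/ 0 < psi 0 by lra.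
  - have [s [s0 [[sep]]]] := locally_pos _ (locally_and _ _ _ lf (locally_lt0 _ _ cpsi neg)).
    by rewrite -psiE // => ? ?; nra.
  - have [s [s0 [[sep]]]] := locally_neg _ (locally_and _ _ _ lf (locally_gt0 _ _ cpsi pos)).
    by rewrite -psiE // => ? ?; nra. }
pose M := \rsum_(y : Y) m z y.
pose S2 := \rsum_(y : Y) (m z y * (d y / w y ^ 2)).
have M0 : 0 < M by apply: (@rsum_gt0 _ _ y0).
pose k0 := (1 - 2 * a z) / 3.
(* The lower divergence bound divided by w^2; summed against [m z y], the term in d/w contributes a
   multiple of [S1], that is, zero. *)
have termlt y : / (2 * h) < d y / w y ^ 2 + k0 / h * (d y / w y).
  have := bkl_lower (a z) (a (nu y)) ht (a01 _) (anu y).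
  have := bkl_den_gt0 (a z) (a (nu y)) ht (a01 _).
  have -> : bkl_den (a z) (a (nu y)) = h + k0 * w y.
    by rewrite /bkl_den /h /k0 /w; field.
  rewrite -/(w y) -/(d y) => B0 lt.
  have lt' : w y ^ 2 < d y * (2 * (h + k0 * w y)).
    have := Rmult_lt_compat_r (2 * (h + k0 * w y)) _ _ ltac:(lra) lt.
    by rewrite /Rdiv Rmult_assoc Rinv_l ?Rmult_1_r //; lra.
  have wp : 0 < w y ^ 2 by apply: pow2_gt_0.
  have -> : / (2 * h) = w y ^ 2 * / (2 * h * w y ^ 2).
    by field; repeat split; first [exact: sepn | exact: wn | lra].
  have -> : d y / w y ^ 2 + k0 / h * (d y / w y) =
     d y * (2 * (h + k0 * w y)) * / (2 * h * w y ^ 2).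
    by field; repeat split; first [exact: sepn | exact: wn | lra].
  apply: Rmult_lt_compat_r => //; apply: Rinv_0_lt_compat.
  by apply: Rmult_lt_0_compat; lra.
have lt2 : M * / (2 * h) < S2.
  have -> : S2 = \rsum_(y : Y) (m z y * (d y / w y ^ 2 + k0 / h * (d y / w y))).
    transitivity (S2 + k0 / h * S1); first by rewrite S10; ring.
    by rewrite /S2 /S1 -rsumM -rsumD; apply: eq_bigr => y _; ring.
  rewrite /M -rsumMr; apply: (@rsum_lt _ _ _ y0).
    by move=> y; apply: Rmult_le_compat_l => //; apply: Rlt_le.
  exact: Rmult_lt_compat_l.
(* The midpoint of the strict inequality [lt2]. Choosing [eta] with M/(2 eta) = [S'] gives
   [eta < h], as the upper bound requires, and still leaves M/(2 eta) below [S2]. *)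
pose S' := (M * / (2 * h) + S2) / 2.
have Mh : 0 < M * / (2 * h).
  by apply: Rmult_lt_0_compat => //; apply: Rinv_0_lt_compat; lra.
have S'0 : 0 < S' by rewrite /S'; lra.
pose eta := M / (2 * S').
have he : 0 < eta < h.
  split; first by apply: Rdiv_lt_0_compat; lra.
  have -> : eta = h * (M * / (2 * h)) / S' by rewrite /eta; field; lra.
  apply: (Rmult_lt_reg_r S') => //.
  rewrite /Rdiv Rmult_assoc Rinv_l ?Rmult_1_r; last lra.
  by apply: Rmult_lt_compat_l => //; rewrite /S'; lra.
(* The bounded cost change divided by s^2: writing d/(w-s) = d/w + s d/(w(w-s)), the first-order
   part is a multiple of [S1] and vanishes. *)
pose psi s := \rsum_(y : Y) (m z y * ((w y * (/ (2 * eta) - d y / w y ^ 2)) / (w y - s))).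
have psiE s : (forall y, 0 < w y * (w y - s)) -> s ^ 2 * psi s =
    \rsum_(y : Y) (m z y * (w y / (w y - s) * (s ^ 2 / (2 * eta)) - s * d y / (w y - s))).
  move=> sep; transitivity (s ^ 2 * psi s - s * S1); first by rewrite S10; ring.
  rewrite /psi /S1 -!rsumM -rsumB; apply: eq_bigr => y _.
  by field; repeat split; first [exact: sepn | exact: wn | lra].
have cpsi : continuous psi 0.
  apply: continuous_rsum => y.
  apply: (@continuous_mult _ R_AbsRing (fun=> m z y)); first exact: continuous_const.
  by apply: cont_inv; exact: continuous_const.
have psi0 : psi 0 < 0.
  have -> : psi 0 = M * / (2 * eta) - S2.
    rewrite /psi /M /S2 -rsumMr -rsumB; apply: eq_bigr => y _.
    by field; repeat split; first [exact: sepn | exact: wn | lra].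
  have -> : M * / (2 * eta) = S' by rewrite /eta; field; lra.
  rewrite /S'; lra.
have lf := locally_and _ _ _ lsep (lfeas' eta he).
have [s [s0 [[sep]]]] := locally_pos _ (locally_and _ _ _ lf (locally_lt0 _ _ cpsi psi0)).
rewrite -psiE // => pos neg.
have := pow_lt s 2 s0; nra.
Qed.

(** * Mutual information and posteriors *)

(** This is I = H(X) - H(X|B). Taking [p] and [a] as parameters also covers letters of zero mass,
    where the position is arbitrary. *)
Lemma mutinfE (B : finType) (pi : bool -> R) (ch : bool -> B -> R) (p a : B -> R) :
  input_dist pi -> stochastic ch -> (forall b, 0 <= p b) -> (forall b, 0 <= a b <= 1) ->
  (forall x b, pi x * ch x b = p b * (if x then 1 - a b else a b)) ->
  mutinf pi ch = \rsum_(b : B) (p b * negent (a b)) -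
     (pi true * ln (pi true) + pi false * ln (pi false)).
Proof.
move=> [pi0 _] [ch0 ch1] p0 a01 joint.
have outE b : outp pi ch b = p b by rewrite /outp big_bool !joint /=; ring.
have term x b : (if Req_EM_T (ch x b) 0 then 0
      else pi x * ch x b * ln (ch x b / outp pi ch b)) =
   p b * ((if x then 1 - a b else a b) * ln (if x then 1 - a b else a b)) -
   pi x * ln (pi x) * ch x b.
  rewrite outE; have := joint x b.
  set c := if x then _ else _ => jE.
  case: Req_EM_T => [chE|chn] /=.
    by rewrite /= -Rmult_assoc -jE chE; ring.
  have pix := pi0 x; have chp : 0 < ch x b by have := ch0 x b; lra.
  have pc : 0 < p b * c by rewrite -jE; apply: Rmult_lt_0_compat.
  have pn : p b <> 0 by move=> E; rewrite E in pc; lra.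
  have cp : 0 < c by have := p0 b; nra.
  have -> : ch x b / p b = c / pi x.
    have -> : ch x b = pi x * ch x b / pi x by field; lra.
    by rewrite jE; field; split; lra.
  rewrite ln_div // jE.
  have -> : pi x * ln (pi x) * ch x b = pi x * ch x b * ln (pi x) by ring.
  rewrite jE; ring.
rewrite /mutinf big_bool /=.
under eq_bigr do rewrite term.
under [X in _ + X = _]eq_bigr do rewrite term.
rewrite !rsumB !rsumM !ch1 /negent.
under [X in _ = X - _]eq_bigr do rewrite Rmult_plus_distr_l.
rewrite rsumD; ring.
Qed.

Lemma outp_post (B : finType) (pi : bool -> R) (ch : bool -> B -> R) (b : B) :
  0 < outp pi ch b ->
  forall x, pi x * ch x b =
    outp pi ch b * (if x then 1 - post pi ch b false else post pi ch b false).
Proof.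
move=> o0; have oE : outp pi ch b = pi true * ch true b + pi false * ch false b.
  by rewrite /outp big_bool.
rewrite /post; case; last by field; lra.
rewrite Rmult_minus_distr_l.
have -> : outp pi ch b * (pi false * ch false b / outp pi ch b) = pi false * ch false b.
  by field; lra.
lra.
Qed.

Lemma post_bounds (B : finType) (pi : bool -> R) (ch : bool -> B -> R) (b : B) :
  input_dist pi -> stochastic ch -> 0 < outp pi ch b -> 0 <= post pi ch b false <= 1.
Proof.
move=> [pi0 _] [ch0 _] o0.
have hf := outp_post B pi ch b o0 false; have ht := outp_post B pi ch b o0 true.
have pf := Rmult_le_pos _ _ (Rlt_le _ _ (pi0 false)) (ch0 false b).
have pt := Rmult_le_pos _ _ (Rlt_le _ _ (pi0 true)) (ch0 true b).
by rewrite /= in hf ht; nra.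
Qed.

Lemma post_true (B : finType) (pi : bool -> R) (ch : bool -> B -> R) (b : B) :
  0 < outp pi ch b -> post pi ch b true = 1 - post pi ch b false.
Proof. by move=> o0; rewrite {1}/post (outp_post _ _ _ _ o0 true); field; lra. Qed.

(** * The joint law of the two outputs as a transport plan *)

Section JointLaw.

Context {Y Z : finType} (W : bool -> Y -> R) (pi : bool -> R).
Context (Q : bool -> Z -> R) (Phi : Z -> Y -> R).

Definition joint_mass (z : Z) (y : Y) : R := outp pi Q z * Phi z y.

Hypotheses (pi_dist : input_dist pi) (W_out : forall y, 0 < outp pi W y).
Hypotheses (Q_stoch : stochastic Q) (Phi_stoch : stochastic Phi).
Hypotheses (WQ : degraded_via W Q Phi) (Q_out : forall z, 0 < outp pi Q z).

Lemma joint_mass_ge0 z y : 0 <= joint_mass z y.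
Proof. by apply: Rmult_le_pos; [apply: Rlt_le|case: Phi_stoch]. Qed.

Lemma joint_mass_input (x : bool) (y : Y) :
  \rsum_(z : Z) (joint_mass z y *
     (if x then 1 - post pi Q z false else post pi Q z false)) = pi x * W x y.
Proof.
rewrite WQ -rsumM; apply: eq_bigr => z _.
have := outp_post _ _ _ _ (Q_out z) x; rewrite /joint_mass => E.
by rewrite -Rmult_assoc E; ring.
Qed.

Lemma joint_mass_false (y : Y) :
  \rsum_(z : Z) (joint_mass z y * post pi Q z false) = pi false * W false y.
Proof. exact: (joint_mass_input false). Qed.

Lemma joint_mass_out (y : Y) : \rsum_(z : Z) joint_mass z y = outp pi W y.
Proof.
rewrite /outp big_bool /= -!joint_mass_input -rsumD.
by apply: eq_bigr => z _ /=; ring.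
Qed.

(** The posterior of [y] is the barycentre of the positions of the letters serving it. *)
Lemma joint_mass_mean (y : Y) :
  \rsum_(z : Z) (joint_mass z y * (post pi Q z false - post pi W y false)) = 0.
Proof.
under eq_bigr do rewrite Rmult_minus_distr_l.
rewrite rsumB rsumMr joint_mass_false joint_mass_out (outp_post _ _ _ _ (W_out y)) /=.
ring.
Qed.

Lemma joint_mass_eq_post (z0 : Z) (y : Y) :
  (forall z, 0 < joint_mass z y -> post pi Q z false = post pi Q z0 false) ->
  post pi Q z0 false = post pi W y false.
Proof.
move=> same; have := joint_mass_mean y.
have -> : \rsum_(z : Z) (joint_mass z y * (post pi Q z false - post pi W y false)) =
   outp pi W y * (post pi Q z0 false - post pi W y false).
  rewrite -joint_mass_out -rsumMr; apply: eq_bigr => z _.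
  have [m0|m0] := Rlt_dec 0 (joint_mass z y); first by rewrite same.
  have -> : joint_mass z y = 0 by have := joint_mass_ge0 z y; lra.
  by ring.
by move/Rmult_integral; have := W_out y; lra.
Qed.

(** A weighted sum of deviations that vanishes and has a negative term must have a positive one; the
    next lemma is symmetric. *)
Lemma joint_mass_above (z0 : Z) (y : Y) : 0 < joint_mass z0 y ->
  post pi Q z0 false < post pi W y false ->
  exists z, 0 < joint_mass z y /\ post pi W y false < post pi Q z false.
Proof.
move=> mz lt; apply: NNPP => no.
suff : \rsum_(z : Z) (joint_mass z y * (post pi Q z false - post pi W y false)) <
   \rsum_(z : Z) 0 by rewrite rsum0 joint_mass_mean; lra.
apply: (@rsum_lt _ _ _ z0) => [z|]; last by nra.
have [m0|m0] := Rlt_dec 0 (joint_mass z y); last first.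
  have -> : joint_mass z y = 0 by have := joint_mass_ge0 z y; lra.
  by rewrite Rmult_0_l; lra.
suff : post pi Q z false <= post pi W y false by nra.
by apply: Rnot_lt_le => lt'; apply: no; exists z.
Qed.

Lemma joint_mass_below (z0 : Z) (y : Y) : 0 < joint_mass z0 y ->
  post pi W y false < post pi Q z0 false ->
  exists z, 0 < joint_mass z y /\ post pi Q z false < post pi W y false.
Proof.
move=> mz lt; apply: NNPP => no.
suff : \rsum_(z : Z) 0 <
   \rsum_(z : Z) (joint_mass z y * (post pi Q z false - post pi W y false)).
  by rewrite rsum0 joint_mass_mean; lra.
apply: (@rsum_lt _ _ _ z0) => [z|]; last by nra.
have [m0|m0] := Rlt_dec 0 (joint_mass z y); last first.
  have -> : joint_mass z y = 0 by have := joint_mass_ge0 z y; lra.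
  by rewrite Rmult_0_l; lra.
suff : post pi W y false <= post pi Q z false by nra.
by apply: Rnot_lt_le => lt'; apply: no; exists z.
Qed.

(** Any competing plan is turned into a feasible pair of channels on the same alphabet; mutual
    information is the plan's cost plus a constant depending on [pi] alone. *)
Lemma joint_mass_optimal : stochastic W ->
  (forall (Q' : bool -> Z -> R) (Phi' : Z -> Y -> R),
     stochastic Q' -> stochastic Phi' -> degraded_via W Q' Phi' ->
     mutinf pi Q <= mutinf pi Q') ->
  optimal_plan joint_mass (fun z => post pi Q z false).
Proof.
move=> W_stoch opt m a m0 a01 mass mean.
have [pi0 pi1] := pi_dist; have [W0 W1] := W_stoch.
pose p z := \rsum_(y : Y) m z y.
have p0 z : 0 <= p z by apply: rsum_ge0.
pose Q' (x : bool) z := p z * (if x then 1 - a z else a z) / pi x.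
(* At a letter of zero mass, the row [W false] merely supplies some probability distribution. *)
pose Phi' z y := if Req_EM_T (p z) 0 then W false y else m z y / p z.
have pPhi z y : p z * Phi' z y = m z y.
  rewrite /Phi'; case: Req_EM_T => pz /=; last by field.
  rewrite pz Rmult_0_l; apply: NNPP => ne.
  have : 0 < p z by apply: (@rsum_gt0 _ _ y) => //; have := m0 z y; lra.
  by rewrite pz; lra.
(* The first-moment constraint is the case [x = false]; subtracting it from the mass constraint
   gives [x = true]. *)
have input x y : \rsum_(z : Z) (m z y * (if x then 1 - a z else a z)) = pi x * W x y.
  have f : \rsum_(z : Z) (m z y * a z) = pi false * W false y.
    by rewrite mean joint_mass_false.
  case: x => //; under eq_bigr do rewrite Rmult_minus_distr_l Rmult_1_r.
  by rewrite rsumB mass joint_mass_out f /outp big_bool /=; ring.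
have joint x z : pi x * Q' x z = p z * (if x then 1 - a z else a z).
  by rewrite /Q'; field; have := pi0 x; lra.
have Q'_stoch : stochastic Q'.
  split=> [x z|x].
    apply: Rdiv_le_0_compat => //; apply: Rmult_le_pos => //.
    by have := a01 z; case: x; lra.
  apply: (Rmult_eq_reg_l (pi x)); last by have := pi0 x; lra.
  rewrite -rsumM; under eq_bigr do rewrite joint.
  rewrite /p; under eq_bigr do rewrite -rsumMr.
  rewrite exchange_big /=; under eq_bigr do rewrite input.
  by rewrite rsumM W1.
have Phi'_stoch : stochastic Phi'.
  split=> z.
    move=> y; rewrite /Phi'; case: Req_EM_T => pz //=.
    by apply: Rdiv_le_0_compat => //; have := p0 z; lra.
  rewrite /Phi'; case: Req_EM_T => [_|pz] /=; first exact: W1.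
  by rewrite /Rdiv rsumMr -/(p z) Rinv_r.
have WQ' : degraded_via W Q' Phi'.
  move=> x y; apply: (Rmult_eq_reg_l (pi x)); last by have := pi0 x; lra.
  rewrite -input -rsumM; apply: eq_bigr => z _.
  by rewrite -Rmult_assoc joint -pPhi; ring.
have := opt Q' Phi' Q'_stoch Phi'_stoch WQ'.
rewrite (mutinfE _ _ _ _ _ pi_dist Q'_stoch p0 a01 joint).
rewrite (mutinfE _ _ _ (outp pi Q) (fun z => post pi Q z false)) //.
- rewrite exchange_big /= [X in _ -> _ <= X]exchange_big /=.
  under [X in _ -> X <= _]eq_bigr do rewrite rsumMr rsumM (proj2 Phi_stoch) Rmult_1_r.
  under [X in _ -> _ <= X]eq_bigr do rewrite rsumMr.
  exact: Rplus_le_reg_r.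
- by move=> z; apply: Rlt_le.
- by move=> z; apply: post_bounds.
- by move=> x z; apply: outp_post.
Qed.

End JointLaw.

(** * Posteriors of an optimizer and the support of [Phi] *)

Theorem theorem12 (Y Z : finType) (W : bool -> Y -> R) (pi : bool -> R) (L : nat)
  (Q : bool -> Z -> R) (Phi : Z -> Y -> R) :
  stochastic W -> input_dist pi -> (forall y, 0 < outp pi W y) ->
  (2 <= L)%nat ->
  (* (Q, Phi) is feasible *)
  stochastic Q -> stochastic Phi -> degraded_via W Q Phi -> (#|Z| <= L)%nat ->
  (forall z, 0 < outp pi Q z) ->
  (* (Q, Phi) is optimal *)
  (forall (Z' : finType) (Q' : bool -> Z' -> R) (Phi' : Z' -> Y -> R),
     stochastic Q' -> stochastic Phi' -> degraded_via W Q' Phi' -> (#|Z'| <= L)%nat ->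
     mutinf pi Q - mutinf pi W <= mutinf pi Q' - mutinf pi W) ->
  (* posterior vectors pairwise distinct *)
  (forall z z', (forall x, post pi Q z x = post pi Q z' x) -> z = z') ->
  (forall z, exists y, forall x, post pi Q z x = post pi W y x) /\
  (forall y z, 0 < Phi z y ->
     (post pi Q z false <= post pi W y false /\
      forall z', post pi Q z' false <= post pi W y false ->
                 post pi Q z' false <= post pi Q z false) \/
     (post pi W y false <= post pi Q z false /\
      forall z', post pi W y false <= post pi Q z' false ->
                 post pi Q z false <= post pi Q z' false)).
Proof.
move=> W_stoch pi_dist W_out _ Q_stoch Phi_stoch WQ cardZ Q_out optQ _.
pose m := joint_mass pi Q Phi; pose a z := post pi Q z false.
have opt : optimal_plan m a.
  apply: (joint_mass_optimal W) => // Q' Phi' Q's Phi's WQ'.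
  by have := optQ Z Q' Phi' Q's Phi's WQ' cardZ; lra.
have m0 z y : 0 <= m z y by apply: joint_mass_ge0.
have a01 z : 0 <= a z <= 1 by apply: post_bounds.
have mpos z y : 0 < Phi z y -> 0 < m z y by move=> h; apply: Rmult_lt_0_compat.
split=> [z|y z /mpos mzy].
- have [y0 /mpos my0] : exists y, 0 < Phi z y.
    by apply: rsum_exists_gt0; rewrite (proj2 Phi_stoch); lra.
  have [y [mzy same]] := optimal_plan_partner _ _ m a z y0 opt m0 a01 my0.
  have E := joint_mass_eq_post W pi Q Phi W_out Phi_stoch WQ Q_out z y same.
  by exists y; case=> //; rewrite !post_true // E.
- have [le|lt] := Rle_lt_dec (a z) (post pi W y false); [left|right]; split.
  + exact: le.
  + move=> z' le'; apply: Rnot_lt_le => lt.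
    (* A closer letter [z'] would lie strictly between [z] and a letter [z2] serving [y] from beyond
       its posterior, contradicting the absence of crossings. *)
    have [z2 [m2 lt2]] : exists z2, 0 < m z2 y /\ post pi W y false < a z2.
      by apply: (joint_mass_above W _ _ _ W_out Phi_stoch WQ Q_out z) => //; lra.
    by apply: (optimal_plan_no_crossing _ _ m a y z z2 z') => //; rewrite /a; rewrite /a in lt2; lra.
  + exact: Rlt_le.
  + move=> z' le'; apply: Rnot_lt_le => lt'.
    have [z1 [m1 lt1]] : exists z1, 0 < m z1 y /\ a z1 < post pi W y false.
      by apply: (joint_mass_below W _ _ _ W_out Phi_stoch WQ Q_out z).
    by apply: (optimal_plan_no_crossing _ _ m a y z1 z z') => //; rewrite /a; rewrite /a in lt1; lra.
Qed.
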